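(* Let $p$ and $q$ be primes and let $(P,\alpha)$ be a maximal $(p,q)$-pair. If $q>2$, then $P$ has nilpotency class at most $2$.
   Context: For a finite group $G$, $\mathrm{d}(G)$ denotes the minimum number of generators of $G$ and $\Phi(G)$ its Frattini subgroup. A power automorphism of a finite group is an automorphism sending every subgroup to itself. Let $p,q$ be primes. A maximal $(p,q)$-pair of rank $d$ is a pair $(P,\alpha)$ where $P$ is a finite $p$-group, $\alpha\in\mathrm{Aut}(P)$ has prime order $q$ dividing $p-1$, and: (a) the minimal number of generators of every subgroup of $P$ is at most $\mathrm{d}(P)=d$; (b) the image of $\alpha$ in $\mathrm{Aut}(P/\Phi(P))$ is a non-trivial power automorphism; (c) if $H$ is a proper subgroup of $P$ with $\mathrm{d}(H)=\mathrm{d}(P)$, then either $\alpha(H)\neq H$ or the image of $\alpha$ in $\mathrm{Aut}(H/\Phi(H))$ is not a non-trivial power automorphism. A maximal $(p,q)$-pair is one of rank $d$ for some $d$. *)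

(* Defs.v *)
From mathcomp Require Import all_boot all_fingroup all_solvable.

Set Implicit Arguments.
Unset Strict Implicit.
Unset Printing Implicit Defensive.

Local Open Scope group_scope.

Definition power_aut (gT : finGroupType) (G : {group gT}) (phi : {perm gT}) :=
  phi \in Aut G /\ forall K : {group gT}, K \subset G -> phi @: K = K.

(* The automorphism of H / 'Phi(H) induced by an automorphism a of a group      *)
(* containing H. It is meaningful only when a @: H = H; see Frattini_autE and   *)
(* Frattini_aut_Aut below. For H the whole group, restr_perm H a is just a.     *)
Definition Frattini_aut (gT : finGroupType) (H : {group gT}) (a : {perm gT}) :
    {perm coset_of 'Phi(H)} :=
  actperm ([Aut H] / 'Phi(H))%act (restr_perm H a).

Definition nontrivial_power_on_Frattini_quotient
    (gT : finGroupType) (H : {group gT}) (a : {perm gT}) :=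
  power_aut (H / 'Phi(H))%G (Frattini_aut H a) /\ Frattini_aut H a <> 1.

Definition maximal_pair_of_rank (p q d : nat)
    (gT : finGroupType) (P : {group gT}) (alpha : {perm gT}) : Prop :=
  [/\ p.-group P,
      alpha \in Aut P /\ (#[alpha] = q /\ q %| p.-1),
      'm(P) = d /\ (forall H : {group gT}, H \subset P -> 'm(H) <= d),
      nontrivial_power_on_Frattini_quotient P alpha
    & forall H : {group gT}, H \proper P -> 'm(H) = 'm(P) ->
        alpha @: H <> H \/ ~ nontrivial_power_on_Frattini_quotient H alpha].

Definition maximal_pair (p q : nat)
    (gT : finGroupType) (P : {group gT}) (alpha : {perm gT}) : Prop :=
  exists d : nat, maximal_pair_of_rank p q d P alpha.

Section FrattiniAutTheory.

Variables (gT : finGroupType) (P H : {group gT}) (a : {perm gT}).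
Hypotheses (sHP : H \subset P) (AutPa : a \in Aut P) (aH : a @: H = H).

Let AutHa : restr_perm H a \in Aut H.
Proof. exact: Aut_restr_perm AutPa. Qed.

Let qdom_a : restr_perm H a \in qact_dom [Aut H] 'Phi(H).
Proof.
rewrite qact_domE ?Phi_sub // inE AutHa inE; apply/subsetP=> x Phx; rewrite inE.
have /charP[_ /(_ _ (injm_autm AutHa) (im_autm AutHa)) defPhi] := Phi_char H.
have: autm AutHa x \in autm AutHa @* 'Phi(H).
  by rewrite mem_morphim ?(subsetP (Phi_sub H)).
by rewrite defPhi.
Qed.

Lemma Frattini_aut_Aut : Frattini_aut H a \in Aut (H / 'Phi(H)).
Proof. exact: (actperm_Aut ([Aut H] / 'Phi(H))%gact qdom_a). Qed.

Lemma Frattini_autE x :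
  x \in H -> Frattini_aut H a (coset 'Phi(H) x) = coset 'Phi(H) (a x).
Proof.
move=> Hx; have nHa : a \in 'N(H | 'P).
  by rewrite !inE; apply/subsetP=> y Hy; rewrite inE /=; have := imset_f a Hy; rewrite aH.
have nPhx : x \in 'N('Phi(H)) by rewrite (subsetP (char_norm (Phi_char H))).
rewrite /Frattini_aut actpermE qactE //; congr (coset _ _).
exact: restr_permE.
Qed.

End FrattiniAutTheory.

(* Main.v *)
Require Import Defs.
From mathcomp Require Import all_boot all_fingroup all_solvable.

(* Say that alpha acts with weight i on an abelian section if it acts as the   *)
(* power map of exponent m ^ i, where m is the scalar by which it acts on      *)
(* P / Phi(P); as q > 2, m ^ 2 != 1 modulo p. In a minimal counterexample      *)
(* L_3(P) lies in every nontrivial alpha-invariant normal subgroup contained   *)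
(* in Phi(P), so it is central, of order p, of weight 3, and no element of     *)
(* order p of Z(P) :&: Phi(P) has weight 1 or 2. Now p-th powers of elements   *)
(* of L_2(P) would yield one of weight 2, those of P one of weight 1, and      *)
(* commutators in C = C_P(L_2(P)) one of weight 2. Hence P has exponent p,     *)
(* Phi(P) = L_2(P), and C is elementary abelian. Commutation                   *)
(* L_2(P) / L_3(P) x P / C -> L_3(P) gives |P : C| <= |L_2(P) : L_3(P)|, so    *)
(* that |C| > |P : Phi(P)|: C needs more generators than P.                    *)
(* In the semidirect product of P by Aut P, alpha becomes conjugation by an    *)
(* element a, which makes the passage to quotients painless.                   *)

Set Implicit Arguments.
Unset Strict Implicit.
Unset Printing Implicit Defensive.
Local Open Scope group_scope.

(** Class at least 3 would clash with the bound on generator numbers: under an automorphism that is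
    scalar modulo Phi(P), it forces an elementary abelian subgroup of rank larger than that of P /
    Phi(P). The core is [scalar_aut_lcn3_eq1], an induction on the order of P whose hypotheses
    survive quotients by invariant normal subgroups inside Phi(P); a minimal counterexample thus
    satisfies [minP] of section [ClassThree]. There [wt2] and [wt3] carry the scalar m along the
    lower central series, and [no_other_weight] kills whatever has the wrong weight, which gives
    [lcn2_expp], [Mho1_eq1] and [cent2_abelian]. The count [cent2_card] supplies the contradiction.
    Since q is odd, m ^ 2 != 1 modulo p; this makes p odd and m ^ 3 distinct from m and m ^ 2 modulo
    p. *)

(** On an abelian group the map x |-> x ^- k * x ^ a is multiplicative, so a congruence of weights
    need only be checked on generators. *)
Lemma abelian_gen_conjX (gT : finGroupType) (S : {set gT}) (D : {group gT}) a k :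
    abelian <<S>> -> D \subset <<S>> ->
    (forall s, s \in S -> s ^- k * s ^ a \in D) ->
  forall x, x \in <<S>> -> x ^- k * x ^ a \in D.
Proof.
move=> cSS sDS DS x Sx.
suff sSK: <<S>> \subset [set y in <<S>> | y ^- k * y ^ a \in D].
  by have:= subsetP sSK x Sx; rewrite inE => /andP[].
have gK: group_set [set y in <<S>> | y ^- k * y ^ a \in D].
  apply/group_setP; split.
    by rewrite inE group1 expg1n invg1 mul1g conj1g group1.
  move=> y z; rewrite !inE => /andP[Sy Dy] /andP[Sz Dz]; rewrite groupM //=.
  have cxy u v: u \in <<S>> -> v \in <<S>> -> commute u v.
    by move=> Su Sv; apply: (centsP cSS).
  have Sza: z ^ a \in <<S>>.
    have:= subsetP sDS _ Dz; rewrite groupMl // groupV groupX //.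
  have Sya: y ^ a \in <<S>>.
    have:= subsetP sDS _ Dy; rewrite groupMl // groupV groupX //.
  rewrite expgMn; last exact: cxy.
  rewrite conjMg invMg -mulgA [y ^- k * _]mulgA.
  rewrite mulgA [z ^- k * _](cxy (z ^- k) (y ^- k * y ^ a)).
  - by rewrite -mulgA groupM.
  - by rewrite groupV groupX.
  by rewrite groupM // groupV groupX.
rewrite (gen_subG _ (Group gK)).
by apply/subsetP=> s Ss; rewrite inE mem_gen ?DS.
Qed.

(** Climb from Z to F by maximal subgroups. Adjoining x to M multiplies |F : Z| by p, and |G :
    C_G(M)| by at most p, because the conjugates of x under G lie in the coset of Z at x. *)
Lemma index_cent_leq (gT : finGroupType) p (G F Z : {group gT}) :
    prime p -> p.-group F -> Z \subset F -> Z \subset 'C(G) -> #|Z| = p ->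
    [~: F, G] \subset Z ->
  #|G : 'C_G(F)| <= #|F : Z|.
Proof.
move=> pr_p pF sZF cGZ oZ; elim: {F}_.+1 {-2}F (ltnSn #|F|) pF sZF => // n IHn F.
rewrite ltnS => leFn pF sZF sRZ.
have [eqFZ | neFZ] := eqVneq (F : {set gT}) Z.
  rewrite eqFZ indexgg; have /setIidPl->: G \subset 'C(Z) by rewrite centsC.
  by rewrite indexgg.
case: (@maximal_exists _ Z F sZF) => [eqZF | [M maxM sZM]].
  by case/eqP: neFZ.
have [sMF _] := andP (maxgroupp maxM).
have [x Fx notMx] := subsetPn (proj2 (andP (maxgroupp maxM))).
have oFM := p_maximal_index pF maxM.
have /IHn leM: #|M| < n by apply: leq_trans leFn; rewrite proper_card ?(maxgroupp maxM).
have {}leM := leM (pgroupS sMF pF) sZM (subset_trans (commSg _ sMF) sRZ).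
have defF: M <*> <[x]> = F.
  apply/eqP; rewrite eqEsubset join_subG sMF cycle_subG Fx /=.
  case/maxgroupP: maxM => _ maxM.
  case: (boolP (M <*> <[x]> \proper F)) => [prF | ].
    have:= maxM _ prF (joing_subl _ _) => eqM.
    by case/negP: notMx; rewrite -eqM mem_gen // inE cycle_id orbT.
  by rewrite properE join_subG sMF cycle_subG Fx /= negbK.
have lex: #|G : 'C_G[x]| <= p.
  rewrite index_cent1 -oZ -(card_lcoset Z x) subset_leq_card //.
  apply/subsetP=> _ /imsetP[y Gy ->]; rewrite mem_lcoset.
  by rewrite -commgEl (subsetP sRZ) ?mem_commg.
have -> : 'C_G(F) = 'C_G(M) :&: 'C_G[x].
  by rewrite -defF centY cent_cycle setIACA setIid.
rewrite -(Lagrange_index sMF sZM) oFM mulnC.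
apply: leq_trans (leq_mul leM lex).
have -> : #|G : 'C_G(M) :&: 'C_G[x]| = (#|'C_G(M) : 'C_G[x]| * #|G : 'C_G(M)|)%N.
  by rewrite -(indexgI 'C_G(M)) mulnC Lagrange_index ?subsetIl.
by rewrite mulnC leq_mul2l [X in _ || X](subset_leq_card (imsetS _ _)) ?orbT ?subsetIl.
Qed.

(** * Weights in groups with central Frattini subgroup *)

Section Commutators.
Variables (gT : finGroupType) (p : nat) (P : {group gT}).
Hypotheses (pr_p : prime p) (pP : p.-group P).

Lemma Phi_sub_center :
    P^`(1) \subset 'Z(P) -> (forall x, x \in P^`(1) -> x ^+ p = 1) ->
  'Phi(P) \subset 'Z(P).
Proof.
move=> sP'Z expP'; rewrite (Phi_joing pP) join_subG sP'Z (MhoE _ pP) gen_subG /=.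
apply/subsetP=> _ /imsetP[x Px ->]; rewrite expn1; apply/centerP.
split; first exact: groupX.
move=> y Py; apply/commgP; have P'xy: [~ x, y] \in P^`(1) by apply: mem_commg.
rewrite commXg ?expP' //; have /centerP[_ cxy] := subsetP sP'Z _ P'xy.
by apply: commute_sym; apply: cxy.
Qed.

(** Central factors drop out of commutators, so [u, v] ^ a = [u ^+ m, v ^+ m] = [u, v] ^+ (m ^
    2). *)
Lemma class2_conjX m a :
    'Phi(P) \subset 'Z(P) -> (forall x, x \in P -> x ^- m * x ^ a \in 'Phi(P)) ->
  forall x, x \in P^`(1) -> x ^ a = x ^+ (m ^ 2).
Proof.
move=> sPhiZ wt x P'x.
have sP'Z: P^`(1) \subset 'Z(P).
  by apply: subset_trans sPhiZ; rewrite (Phi_joing pP) joing_subl.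
suff: x ^- (m ^ 2) * x ^ a \in [1 gT].
  by rewrite inE -eq_mulVg1 => /eqP.
apply: abelian_gen_conjX P'x; rewrite ?sub1G //.
  exact: abelianS sP'Z (center_abelian _).
move=> _ /imset2P[u v Pu Pv ->]; rewrite inE -eq_mulVg1 eq_sym.
have cZ z y: z \in 'Z(P) -> y \in P -> commute z y by move=> /centerP[_]; apply.
have /(subsetP sPhiZ) Zf := wt u Pu; have /(subsetP sPhiZ) Zg := wt v Pv.
have Zuv: [~ u, v] \in 'Z(P) by rewrite (subsetP sP'Z) ?mem_commg.
rewrite conjRg -(mulKVg (u ^+ m) (u ^ a)) -(mulKVg (v ^+ m) (v ^ a)).
set f := _ * _ in Zf *; set g := _ * _ in Zg *.
have [Pf Pg]: f \in P /\ g \in P by case/centerP: Zf => ? _; case/centerP: Zg.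
have Pum: u ^+ m \in P by rewrite groupX.
have Pvm: v ^+ m \in P by rewrite groupX.
have cfX: [~ f, v ^+ m * g] = 1.
  by apply/eqP/commgP; apply: cZ => //; apply: groupM.
have cgX: [~ u ^+ m, g] = 1 by apply/eqP/commgP/commute_sym; apply: cZ.
rewrite commMgJ cfX mulg1 commgMJ cgX mul1g.
rewrite -conjgM (conjgE _ (g * f)) (commute_sym (cZ _ _ (groupM Zg Zf) _)); last first.
  by rewrite groupR.
rewrite mulKg.
rewrite commXXg ?mulnn //; apply: commute_sym; exact: cZ.
Qed.

End Commutators.

Lemma expn_mod_neq p m i : prime p -> coprime p m -> m ^ 2 != 1 %[mod p] ->
  0 < i < 3 -> m ^ i != m ^ 3 %[mod p].
Proof.
move=> pr_p co_mp m2neq1 /andP[i_gt0 i_lt3]; have m_gt0: 0 < m.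
  by case: m co_mp (prime_gt1 pr_p) {m2neq1} => //; rewrite /coprime gcdn0 => /eqP->.
apply: contra m2neq1; rewrite -(subnKC (ltnW i_lt3)) expnD eq_sym.
rewrite eqn_mod_dvd; last by rewrite leq_pmulr // expn_gt0 m_gt0.
rewrite -{2}[(m ^ i)%N]muln1 -mulnBr Gauss_dvdr ?coprimeXr //.
rewrite -eqn_mod_dvd ?expn_gt0 ?m_gt0 // => eq_m1.
case: i eq_m1 i_gt0 i_lt3 => [|[|[|i]]] // /eqP; rewrite expn1 => eq_m1 _ _.
by rewrite -modnXm eq_m1 modnXm exp1n.
Qed.

(** Downward induction on the exponent: when bounding it by p ^ k0, one may assume that p ^ k.+1
    already works. *)
Lemma pgroup_expg_descent (gT : finGroupType) (p : nat) (H : {group gT}) k0 :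
    p.-group H ->
    (forall k, k0 <= k -> (forall x, x \in H -> x ^+ (p ^ k.+1) = 1) ->
       forall x, x \in H -> x ^+ (p ^ k) = 1) ->
  forall x, x \in H -> x ^+ (p ^ k0) = 1.
Proof.
move=> pH step.
have expH n: exists2 k, n <= k & forall x, x \in H -> x ^+ (p ^ k) = 1.
  have [k ek] := p_natP (etrans (pnat_exponent p H) pH).
  exists (n + k)%N => [|x Hx]; first exact: leq_addr.
  apply/eqP; rewrite -order_dvdn (dvdn_trans (dvdn_exponent Hx)) // ek.
  by rewrite dvdn_exp2l ?leq_addl.
have [k lek] := expH k0; rewrite -(subnKC lek).
elim: (k - k0)%N => [|i IHi]; first by rewrite addn0.
by rewrite addnS => /step; move/(_ (leq_addr _ _))/IHi.
Qed.

(** * Weights on the lower central series of a minimal counterexample *)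

Section ClassThree.

Variables (gT : finGroupType) (p m : nat) (P : {group gT}) (a : gT).
Hypotheses (pr_p : prime p) (pP : p.-group P) (nPa : a \in 'N(P)).
Hypothesis wt1 : forall x, x \in P -> x ^- m * x ^ a \in 'Phi(P).
Hypotheses (co_mp : coprime p m) (m2neq1 : m ^ 2 != 1 %[mod p]).
Hypothesis minP : forall N : {group gT}, N <| P -> a \in 'N(N) ->
  N \subset 'Phi(P) -> N :!=: 1 -> 'L_3(P) \subset N.
Hypothesis ntL3 : 'L_3(P) != 1.

Let L2 := 'L_2(P)%G.
Let L3 := 'L_3(P)%G.

Lemma norm_char (H : {group gT}) : H \char P -> a \in 'N(H).
Proof.
move=> chH; have: <[a]> \subset 'N(P) by rewrite cycle_subG.
by move/(char_norm_trans chH); rewrite cycle_subG.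
Qed.

Lemma lcn2_sub_Phi : L2 \subset 'Phi(P).
Proof. by rewrite (Phi_joing pP) joing_subl. Qed.

Lemma lcn3_sub_Phi : L3 \subset 'Phi(P).
Proof. exact: subset_trans (lcn_subS 2 P) lcn2_sub_Phi. Qed.

(** Otherwise [minP] puts L_3 inside L_4 = [L_3, P], impossible for a nontrivial L_3 in a nilpotent
    group. *)
Lemma lcn4_eq1 : 'L_4(P) = 1.
Proof.
apply/eqP/negPn/negP=> nt4; case/negP: ntL3; apply/eqP.
have sL: L3 \subset 'L_4(P).
  apply: (minP (N := 'L_4(P)%G)) => //; first exact: lcn_normal.
    exact/norm_char/lcn_char.
  exact: subset_trans (lcn_subS 3 P) lcn3_sub_Phi.
apply: (eqP (implyP (forallP (pgroup_nil pP) L3) _)).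
by rewrite subsetI lcn_sub -lcnSn.
Qed.

Lemma lcn3_central : L3 \subset 'Z(P).
Proof.
rewrite subsetI lcn_sub /=; apply/commG1P; rewrite -lcnSn; exact: lcn4_eq1.
Qed.

Lemma commute_lcn3 x y : x \in L3 -> y \in P -> commute x y.
Proof. by move/(subsetP lcn3_central)/centerP=> [_]; apply. Qed.

Lemma mem_comm2 x y : x \in P -> y \in P -> [~ x, y] \in L2.
Proof. exact: mem_commg. Qed.

Lemma mem_comm3 x y : x \in L2 -> y \in P -> [~ x, y] \in L3.
Proof. exact: mem_commg. Qed.

Lemma lcn3_abelian : abelian L3.
Proof. exact: abelianS lcn3_central (center_abelian P). Qed.

Lemma lcn2_abelian : abelian L2.
Proof.
apply/commG1P; apply: three_subgroup.
  by rewrite [X in commutator X _]commGC; exact: lcn4_eq1.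
exact: lcn4_eq1.
Qed.

Lemma cent2_commute x y : x \in L2 -> y \in P -> commute x [~ x, y].
Proof.
move=> L2x Py; apply/commute_sym/commute_lcn3; first exact: mem_comm3.
exact: subsetP (lcn_sub 2 P) x L2x.
Qed.

Lemma lcn2_commX x y k :
  x \in L2 -> y \in P -> [~ x ^+ k, y] = [~ x, y] ^+ k.
Proof. by move=> L2x Py; apply/commXg/cent2_commute. Qed.

Lemma lcn3_expp x : x \in L3 -> x ^+ p = 1.
Proof.
have [Phi1 | ntPhi] := eqVneq 'Phi(L3) 1.
  move/eqP: Phi1; rewrite (trivg_Phi (pgroupS (lcn_sub 3 P) pP)).
  by case/(abelemP pr_p)=> _; apply.
have chPhi: 'Phi(L3)%G \char P by apply: char_trans (Phi_char _) (lcn_char 3 P).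
have sL3: L3 \subset 'Phi(L3).
  apply: (minP (N := 'Phi(L3)%G)) => //; first exact: char_normal.
    exact: norm_char.
  exact: subset_trans (Phi_sub _) lcn3_sub_Phi.
by have := proper_subn (Phi_proper ntL3); rewrite sL3.
Qed.

Lemma lcn2_expp_center x k : x \in L2 -> p %| k -> x ^+ k \in 'Z(P).
Proof.
move=> L2x /dvdnP[i ->]; apply/centerP; split.
  by rewrite groupX ?(subsetP (lcn_sub 2 P)).
move=> y Py; apply/commgP; rewrite lcn2_commX // mulnC expgM.
by rewrite lcn3_expp ?expg1n ?mem_comm3.
Qed.

Lemma Phi_cent_lcn2 : 'Phi(P) \subset 'C(L2).
Proof.
rewrite (Phi_joing pP) join_subG [X in X && _]lcn2_abelian (MhoE _ pP) gen_subG /=.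
apply/subsetP=> _ /imsetP[x Px ->]; apply/centP=> y L2y.
apply/commute_sym/commgP; rewrite expn1 commgX; last first.
  by apply/commute_sym/commute_lcn3; rewrite ?mem_comm3.
by rewrite lcn3_expp ?mem_comm3.
Qed.

(** Modulo [D] the derived subgroup of P is central of exponent p; hence Phi(P / D) is central and
    [class2_conjX] applies. *)
Let D := ('Mho^1(L2) <*> L3)%G.

Lemma charD : D \char P.
Proof.
apply: charY (lcn_char 3 P); exact: char_trans (Mho_char _ _) (lcn_char 2 P).
Qed.

Lemma sDL2 : D \subset L2.
Proof. by rewrite join_subG Mho_sub lcn_subS. Qed.

Lemma wt2 x : x \in L2 -> x ^- (m ^ 2) * x ^ a \in D.
Proof.
have nDP : P \subset 'N(D) := char_norm charD.
have nDa : a \in 'N(D) := norm_char charD.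
have L2P := subsetP (lcn_sub 2 P).
have pPD : p.-group (P / D) by rewrite quotient_pgroup.
have derPD : (P / D)^`(1) = L2 / D by rewrite -quotient_der.
have sPhiZ : 'Phi(P / D) \subset 'Z(P / D).
  apply: (Phi_sub_center (p := p)) => //=; rewrite derPD.
    rewrite subsetI quotientS ?lcn_sub //= quotient_cents2r //.
    by rewrite -lcnSn joing_subr.
  move=> _ /morphimP[x0 Nx0 L2x0 ->]; rewrite -morphX //; apply: coset_id.
  rewrite mem_gen // inE -{1}(expn1 p) Mho_p_elt //.
  exact: mem_p_elt pP (L2P _ L2x0).
move=> L2x; have Nx := subsetP nDP _ (L2P _ L2x).
apply: coset_idr; first by rewrite groupM ?groupV ?groupX ?groupJ.
rewrite morphM ?groupV ?groupX ?groupJ // morphV ?groupX // morphX // morphJ //.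
apply/eqP; rewrite -eq_mulVg1 eq_sym; apply/eqP.
apply: (class2_conjX pPD sPhiZ) => /=; last by rewrite derPD mem_quotient.
move=> _ /morphimP[y Ny Py ->].
rewrite -morphX // -morphJ // -morphV ?groupX // -morphM ?groupV ?groupX ?groupJ //.
by rewrite -(quotient_Phi pP) // mem_quotient ?wt1.
Qed.

(** For y in L_2 and z in P, y ^ a is y ^+ (m ^ 2) times a central element of [D], and z ^ a is z ^+
    m times an element of Phi(P), which centralizes L_2. Both corrections vanish in [y, z] ^ a. *)
Lemma wt3 x : x \in L3 -> x ^ a = x ^+ (m ^ 3).
Proof.
move=> L3x; suff: x ^- (m ^ 3) * x ^ a \in [1 gT].
  by rewrite inE -eq_mulVg1 => /eqP.
apply: abelian_gen_conjX L3x; rewrite ?sub1G //; first exact: lcn3_abelian.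
move=> _ /imset2P[y z L2y Pz ->]; rewrite inE -eq_mulVg1 eq_sym.
have L2P := subsetP (lcn_sub 2 P).
have := wt2 L2y; have := wt1 Pz.
rewrite conjRg -{2}(mulKVg (y ^+ (m ^ 2)) (y ^ a)) -{2}(mulKVg (z ^+ m) (z ^ a)).
set f := _ * _; set d := _ * _ => Phif Dd.
have Pd: d \in P by rewrite L2P ?(subsetP sDL2).
have L2yX: y ^+ (m ^ 2) \in L2 by rewrite groupX.
have cZd: d \in 'Z(P).
  move: d Dd {Pd}; apply/subsetP; rewrite join_subG lcn3_central andbT.
  rewrite (MhoE _ (pgroupS (lcn_sub 2 P) pP)) gen_subG.
  by apply/subsetP=> _ /imsetP[t L2t ->]; rewrite lcn2_expp_center.
have /centerP[_ cPd] := cZd.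
have Pf: f \in P := subsetP (Phi_sub P) f Phif.
have cfy: [~ y ^+ (m ^ 2), f] = 1.
  by apply/eqP/commgP/commute_sym; apply: (centP (subsetP Phi_cent_lcn2 f Phif) _ L2yX).
have cdz: [~ d, z ^+ m * f] = 1.
  by apply/eqP/commgP; apply: cPd; apply: groupM => //; apply: groupX.
rewrite commMgJ cdz mulg1 commgMJ cfy mul1g -conjgM.
rewrite conjgE (commute_lcn3 (mem_comm3 L2yX (groupX _ Pz))); last exact: groupM.
rewrite mulKg commXXg -?expnSr //; first exact: cent2_commute.
by apply/commute_sym/commute_lcn3; rewrite ?mem_comm3.
Qed.

(** A nontrivial z would generate an invariant normal subgroup of order p in Phi(P), which must
    equal L_3 and so have weight 3. *)
Lemma no_other_weight i z : 0 < i < 3 ->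
  z \in 'Z(P) -> z \in 'Phi(P) -> z ^+ p = 1 -> z ^ a = z ^+ (m ^ i) -> z = 1.
Proof.
move=> lt_i Zz Phiz zp za; apply/eqP/negPn/negP=> ntz.
have oz: #[z] = p by apply/nt_prime_order.
have Pz: z \in P by case/centerP: Zz.
have sL3z: L3 \subset <[z]>.
  apply: minP; rewrite ?cycle_subG ?cycle_eq1 //.
    rewrite /(_ <| _) cycle_subG Pz cents_norm // centsC cycle_subG.
    by case/setIP: Zz.
  by rewrite -cycle_subG norms_cycle za mem_cycle.
have L3z: z \in L3.
  suff ->: L3 :=: <[z]> by apply: cycle_id.
  apply/eqP; rewrite eqEcard sL3z /=; move: (cardSg sL3z); rewrite -orderE oz.
  case/primeP: pr_p => _ /[apply]; rewrite -trivg_card1 => /orP[|/eqP->//].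
  by move/(negP ntL3).
have := wt3 L3z; rewrite za => /eqP; rewrite eq_expg_mod_order oz.
by apply/negP/expn_mod_neq.
Qed.

(** * P has exponent p *)

Lemma p_gt2 : 2 < p.
Proof.
rewrite ltn_neqAle prime_gt1 // andbT; apply/eqP=> p2; case/negP: m2neq1.
by move: co_mp; rewrite -p2 coprime2n !modn2 oddX /= => ->.
Qed.

Lemma lcn2_expp x : x \in L2 -> x ^+ p = 1.
Proof.
have pL2 := pgroupS (lcn_sub 2 P) pP.
(* The descent stops at 1: for k >= 1, p divides p ^ k, which makes x ^+ (p ^ k) central. It has
   weight 2 since p ^ k also kills [D]. *)
rewrite -(expn1 p); apply: (pgroup_expg_descent pL2) x => k k_gt0 expL2 x L2x.
have p_dv_k: p %| p ^ k by rewrite dvdn_exp.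
have Dk d: d \in D -> d ^+ (p ^ k) = 1.
  have nMhoL3: L3 \subset 'N('Mho^1(L2)).
    by apply: subset_trans (lcn_subS 2 P) (gFnorm _ L2).
  rewrite -[d \in D]/(d \in 'Mho^1(L2) <*> L3) norm_joinEr //.
  case/mulsgP=> u l Mu L3l ->.
  have /imsetP[t L2t ->]: u \in [set x ^+ (p ^ 1) | x in L2].
    by rewrite -(MhoEabelian 1 pL2 lcn2_abelian).
  rewrite expn1 expgMn; last first.
    by apply/commute_sym/commute_lcn3; rewrite ?groupX ?(subsetP (lcn_sub 2 P)).
  rewrite -expgM -expnS expL2 // mul1g; have [i ->] := dvdnP p_dv_k.
  by rewrite mulnC expgM lcn3_expp ?expg1n.
apply: (@no_other_weight 2) => //; first exact: lcn2_expp_center.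
- by rewrite groupX ?(subsetP lcn2_sub_Phi).
- by rewrite -expgM -expnSr expL2.
have Dd := wt2 L2x; rewrite conjXg -{1}(mulKVg (x ^+ (m ^ 2)) (x ^ a)).
rewrite expgMn; last first.
  by apply: (centsP lcn2_abelian) (groupX _ L2x) _ (subsetP sDL2 _ Dd).
by rewrite [X in _ * X]Dk // mulg1 -!expgM mulnC.
Qed.

(** In (x * c) ^+ p = x ^+ p * c ^+ p * [~ c, x] ^+ 'C(p, 2), the last factor is trivial because p
    is odd. *)
Lemma expMp_lcn2 x c : x \in P -> c \in L2 -> (x * c) ^+ p = x ^+ p.
Proof.
move=> Px L2c; have L3cx := mem_comm3 L2c Px.
rewrite expMg_Rmul; last 2 first.
- exact: cent2_commute.
- by apply/commute_sym/commute_lcn3.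
have /dvdnP[i ->]: p %| 'C(p, 2) by rewrite prime_dvd_bin ?p_gt2.
by rewrite mulnC expgM (lcn3_expp L3cx) expg1n (lcn2_expp L2c) !mulg1.
Qed.

Lemma expp_center x : x \in P -> x ^+ p \in 'Z(P).
Proof.
move=> Px; apply/centerP; split; first exact: groupX.
move=> y Py; apply/commgP; rewrite commgEl conjXg.
by rewrite -[x ^ y](mulKVg x) -commgEl expMp_lcn2 ?mulVg ?mem_comm2.
Qed.

Let M := 'Mho^1(P)%G.

Lemma Mho1_center : 'Mho^1(P) \subset 'Z(P).
Proof.
rewrite (MhoE 1 pP) gen_subG; apply/subsetP=> _ /imsetP[x Px ->].
exact: expp_center.
Qed.

Lemma Mho1_abelian : abelian M.
Proof. exact: abelianS Mho1_center (center_abelian P). Qed.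

(* As [P^p] is central, [(x ^+ m * c * z) ^+ p] only involves class 2 formulas. *)
Lemma Mho1_conj x : x \in M -> x ^- m * x ^ a \in 'Mho^1(M).
Proof.
have defM: M :=: <<[set x ^+ (p ^ 1) | x in P]>> by apply: MhoE.
rewrite defM; apply: abelian_gen_conjX; rewrite -?defM ?Mho1_abelian ?Mho_sub //.
move=> _ /imsetP[y Py ->]; rewrite expn1.
have := wt1 Py; rewrite conjXg -{2}(mulKVg (y ^+ m) (y ^ a)).
move: (_ * _) => f; rewrite (Phi_joing pP) norm_joinEr; last first.
  by rewrite (subset_trans (Mho_sub _ _)) ?der_norm.
case/mulsgP=> c z L2c Mz ->; rewrite mulgA expgMn; last first.
  have /centerP[_ cz] := subsetP Mho1_center _ Mz.
  exact/commute_sym/cz/(groupM (groupX m Py) (subsetP (lcn_sub 2 P) c L2c)).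
rewrite expMp_lcn2 ?groupX // -!expgM mulnC mulKg -(expn1 p).
by rewrite Mho_p_elt // (mem_p_elt pP) ?(subsetP (Mho_sub 1 P)).
Qed.

Lemma Mho1_eq1 : M :=: 1.
Proof.
have pM: p.-group M by apply: pgroupS (Mho_sub _ _) pP.
have sMPhi: M \subset 'Phi(P) by rewrite (Phi_joing pP) joing_subr.
(* Here the descent goes down to 0, that is, to y itself, since elements of [M] are already
   central. *)
apply/trivgP/subsetP=> y My; rewrite inE -[y]expg1 -[1%N](expn0 p); apply/eqP.
apply: (pgroup_expg_descent pM) y My => k _ expM x Mx.
apply: (@no_other_weight 1) => //.
- by rewrite groupX ?(subsetP Mho1_center).
- by rewrite groupX ?(subsetP sMPhi).
- by rewrite -expgM -expnSr expM.
have Dd := Mho1_conj Mx; rewrite conjXg -{1}(mulKVg (x ^+ m) (x ^ a)).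
rewrite (MhoEabelian _ pM Mho1_abelian) in Dd.
have [t Mt ->] := imsetP Dd; rewrite expgMn; last first.
  by apply: (centsP Mho1_abelian); rewrite ?groupX.
by rewrite expn1 -!expgM -expnS expM // mulg1 mulnC.
Qed.

Lemma Phi_lcn2 : 'Phi(P) = L2.
Proof. by rewrite (Phi_joing pP) [X in _ <*> X]Mho1_eq1 joingG1. Qed.

Lemma expp_eq1 x : x \in P -> x ^+ p = 1.
Proof.
move=> Px; apply/set1gP; rewrite -Mho1_eq1 -(expn1 p) Mho_p_elt //.
exact: mem_p_elt pP Px.
Qed.

(** * The centralizer of L_2 is elementary abelian and too large *)

Let C := 'C_P(L2)%G.

Lemma cent2_comm_center : [~: C, C] \subset 'Z(P).
Proof.
rewrite subsetI comm_subG ?subsetIl //=; apply/commG1P.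
have cCL: [~: P, C, C] = 1.
  apply/commG1P/(subset_trans (commgS P (subsetIl P _))).
  by rewrite centsC subsetIr.
apply: three_subgroup => //; by rewrite [X in commutator X _]commGC.
Qed.

(** The corrections to x ^+ m and y ^+ m lie in L_2, which commutes with [C] and with itself; hence
    [x, y] has weight 2, and it is central and killed by p. *)
Lemma cent2_abelian : abelian C.
Proof.
apply/centsP=> x Cx y Cy; apply/commgP; apply/eqP.
have [[Px cx] [Py cy]] := (setIP Cx, setIP Cy).
have Zxy: [~ x, y] \in 'Z(P) by rewrite (subsetP cent2_comm_center) ?mem_commg.
have /centerP[_ cZ] := Zxy.
have L2xy := mem_comm2 Px Py.
apply: (@no_other_weight 2) => //; first by rewrite Phi_lcn2.
  exact: lcn2_expp.
have := wt1 Px; have := wt1 Py; rewrite Phi_lcn2.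
rewrite conjRg -{2}(mulKVg (x ^+ m) (x ^ a)) -{2}(mulKVg (y ^+ m) (y ^ a)).
set g := _ * _; set f := _ * _ => L2g L2f.
have cfg: [~ f, y ^+ m * g] = 1.
  apply/eqP/commgP; apply: commuteM; last exact: (centsP lcn2_abelian).
  by apply/commute_sym; apply: (centP (groupX m cy)).
have cxg: [~ x ^+ m, g] = 1.
  by apply/eqP/commgP; apply: (centP (groupX m cx)).
have L2P := subsetP (lcn_sub 2 P).
have eXY: [~ x ^+ m, y ^+ m] = [~ x, y] ^+ (m ^ 2).
  by rewrite commXXg ?mulnn //; apply: commute_sym; apply: cZ.
rewrite commMgJ cfg mulg1 commgMJ cxg mul1g -conjgM eXY.
have cgf: commute ([~ x, y] ^+ (m ^ 2)) (g * f).
  by apply/commute_sym/commuteX/commute_sym/cZ/groupM; apply: L2P.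
by rewrite conjgE cgf mulKg.
Qed.

Lemma cent2_card : #|P : 'Phi(P)| < #|C|.
Proof.
have oL3: #|L3| = p.
  have [z L3z ntz] := trivgPn _ ntL3.
  have oz: #[z] = p by apply: nt_prime_order; rewrite ?lcn3_expp.
  have sL3z: L3 \subset <[z]>.
    apply: minP; rewrite ?cycle_subG ?cycle_eq1 ?(subsetP lcn3_sub_Phi) //.
      rewrite /(_ <| _) cycle_subG (subsetP (lcn_sub 3 P)) // cents_norm //.
      rewrite centsC cycle_subG.
      by have:= subsetP lcn3_central _ L3z; case/setIP.
    by rewrite -cycle_subG norms_cycle wt3 // mem_cycle.
  rewrite -oz orderE; congr #|pred_of_set _|; apply/eqP.
  by rewrite eqEsubset sL3z cycle_subG.
have iC: #|P : C| <= #|L2 : L3|.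
  apply: (index_cent_leq pr_p (pgroupS (lcn_sub 2 P) pP) (lcn_subS 2 P)) oL3 _ => //.
  by have := lcn3_central; rewrite subsetI => /andP[].
have := Lagrange (subsetIl P 'C(L2)); have := Lagrange (lcn_sub 2 P).
rewrite -(Lagrange (lcn_subS 2 P)) oL3 Phi_lcn2 => <- eqP.
have L0: 0 < #|L2 : L3| by [].
(* If |C| <= |P : L_2|, then |P| = |C| |P : C| <= |P : L_2| |L_2 : L_3| = |P| / p. *)
rewrite ltnNge; apply/negP=> leC; move: (prime_gt1 pr_p); rewrite ltnNge; case/negP.
rewrite -(leq_pmul2r L0) mul1n -(leq_pmul2r (indexg_gt0 P L2)) /= -eqP mulnC.
exact: leq_mul.
Qed.

Lemma cent2_abelem : p.-abelem C.
Proof.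
apply/(abelemP pr_p); split; first exact: cent2_abelian.
by move=> x /setIP[/expp_eq1].
Qed.

End ClassThree.

(** * Induction on the order of the group *)

(** The rank bound is phrased with |P : Phi(P)| because this index is unchanged in P / N for N
    inside Phi(P). *)
Lemma scalar_aut_lcn3_eq1 (gT : finGroupType) (p m : nat) (P : {group gT}) a :
    prime p -> p.-group P -> a \in 'N(P) ->
    (forall x, x \in P -> x ^- m * x ^ a \in 'Phi(P)) ->
    coprime p m -> m ^ 2 != 1 %[mod p] ->
    (forall H : {group gT}, H \subset P -> 'm(H) <= logn p #|P : 'Phi(P)|) ->
  'L_3(P) = 1.
Proof.
move: {2}_.+1 (ltnSn #|P|) => n.
elim: n => // n IHn in gT P a *; rewrite ltnS => lePn.
move=> pr_p pP nPa wt1 co_mp m2neq1 grankP.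
apply/eqP/negPn/negP=> ntL3.
have minP (N : {group gT}) : N <| P -> a \in 'N(N) ->
  N \subset 'Phi(P) -> N :!=: 1 -> 'L_3(P) \subset N.
  move=> nNP nNa sNPhi ntN; have [sNP nNP_] := andP nNP.
  have nsub := subsetP nNP_.
  rewrite -quotient_sub1 ?(subset_trans (lcn_sub 3 P)) //.
  have ->: 'L_3(P) / N = 'L_3(P / N) := morphim_lcn _ 3 nNP_.
  apply/trivgP/(IHn _ (P / N)%G (coset N a)); rewrite ?quotient_pgroup //.
  - by rewrite (leq_trans _ lePn) // ltn_quotient.
  - rewrite -cycle_subG -quotient_cycle // quotient_norms // cycle_subG //.
  - move=> _ /morphimP[x Nx Px ->]; rewrite -(quotient_Phi pP) //.
    rewrite -morphX // -morphJ // -morphV ?groupX // -morphM ?groupV ?groupX ?groupJ //.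
    by rewrite mem_quotient ?wt1.
  move=> H sHPN; have [K defH sNK sKP] := inv_quotientS nNP sHPN.
  rewrite defH; apply: leq_trans (quotient_grank (subset_trans sKP nNP_)) _.
  rewrite -(quotient_Phi pP) //= index_quotient_eq ?grankP ?gFsub //.
  by rewrite subIset // sNPhi orbT.
have abC := cent2_abelem pr_p pP nPa wt1 co_mp m2neq1 minP ntL3.
have := cent2_card pr_p pP nPa wt1 co_mp m2neq1 minP ntL3.
have := grankP _ (subsetIl P 'C('L_2(P))).
rewrite grank_abelian ?(abelem_abelian abC) // (rank_abelem abC).
rewrite -(leq_exp2l _ _ (prime_gt1 pr_p)) -card_pgroup ?(abelem_pgroup abC) //.
rewrite -p_part part_pnat_id ?(pnat_dvd (dvdn_indexg _ _)) //.
by rewrite leqNgt => /negP.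
Qed.

(** * From the maximal pair to a scalar action *)

(** Burnside's basis theorem: lifts of generators of P / Phi(P) generate P. *)
Lemma grank_leq_logn_Phi (gT : finGroupType) (p : nat) (P : {group gT}) :
  p.-group P -> 'm(P) <= logn p #|P : 'Phi(P)|.
Proof.
move=> pP; have [sPhiP nPhiP] := andP (Phi_normal P).
rewrite -card_quotient // -(rank_abelem (Phi_quotient_abelem pP)).
rewrite -grank_abelian ?(abelem_abelian (Phi_quotient_abelem pP)) //.
have [B defB <-] := grank_witness (P / 'Phi(P))%G.
have reprB b : b \in B -> exists2 x, x \in P & b = coset 'Phi(P) x.
  move=> Bb; have: b \in <<B>> by apply: mem_gen.
  by rewrite defB; case/morphimP=> x _ Px ->; exists x.
(* The default 1 is never reached for b in [B], by [reprB]. *)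
pose r b := odflt 1 [pick x in P | b == coset 'Phi(P) x].
have rP b : b \in B -> r b \in P /\ coset 'Phi(P) (r b) = b.
  move=> /reprB[x Px ->]; rewrite /r; case: pickP => [y /andP[Py /eqP->] //|].
  by move/(_ x); rewrite Px eqxx.
have sXP: r @: B \subset P by apply/subsetP=> _ /imsetP[b /rP[Pb _] ->].
apply: leq_trans (leq_imset_card r (mem B)).
rewrite -{1}(@Phi_nongen _ P (r @: B)) ?grank_min //.
apply/eqP; rewrite eqEsubset join_subG sPhiP sXP /=.
rewrite -joing_idr -(quotientSGK nPhiP) ?joing_subl //=.
rewrite quotientYidl ?gen_subG ?(subset_trans sXP) //.
have ->: P / 'Phi(P) = <<B>> by [].
rewrite quotient_gen ?(subset_trans sXP) // gen_subG.
apply/subsetP=> b Bb; have [Prb {1}<-] := rP b Bb.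
by rewrite mem_gen // mem_morphim ?imset_f ?(subsetP nPhiP).
Qed.

(** If v and w are independent, sending v * w to a power of itself forces the exponents at v and w
    to agree modulo p. *)
Lemma power_aut_abelem (gT : finGroupType) (p : nat) (V : {group gT}) phi :
    prime p -> p.-abelem V -> power_aut V phi ->
  exists m, forall v, v \in V -> phi v = v ^+ m.
Proof.
move=> pr_p abV [AutV phiS]; have [pV cVV _] := and3P abV.
have cyc v : v \in V -> exists k, phi v = v ^+ k.
  move=> Vv; apply/cycleP; rewrite -(phiS <[v]>%G) ?cycle_subG //.
  by rewrite imset_f ?cycle_id.
have [V1 | /trivgPn[v Vv ntv]] := eqVneq (V : {set gT}) 1.
  exists 1%N => v; rewrite V1 => /set1P->; rewrite expg1.
  by rewrite -(autmE AutV) morph1.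
have [m phiv] := cyc v Vv; exists m => w Vw.
have [vw | notvw] := boolP (w \in <[v]>).
  have /cycleP[k ->] := vw; rewrite -(autmE AutV) morphX //= autmE phiv.
  by rewrite -!expgM mulnC.
have [k phiw] := cyc w Vw; have [l phivw] := cyc _ (groupM Vv Vw).
have := phivw; rewrite -(autmE AutV) morphM //= autmE phiv phiw.
rewrite expgMn; last exact: (centsP cVV).
have nt_order u : u \in V -> u != 1 -> #[u] = p.
  by move=> Vu ntu; apply: nt_prime_order; case/(abelemP pr_p): abV => // _ ->.
have ov := nt_order v Vv ntv.
have ow: #[w] = p by apply: nt_order => //; apply: contraNneq notvw => ->.
have tivw: <[w]> :&: <[v]> = 1.
  by apply: prime_TIg; rewrite -?orderE ?ow // cycle_subG.
move=> eqvw; have eqvw1: v ^- l * v ^+ m = w ^+ l * w ^- k.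
  by apply: (mulIg (w ^+ k)); rewrite -!mulgA mulVg mulg1 eqvw mulKg.
have /set1gP v1: v ^- l * v ^+ m \in [1 gT].
  rewrite -tivw inE {1}eqvw1 !groupM ?groupV ?mem_cycle //.
have eq_lm: l = m %[mod p].
  by apply/eqP; rewrite -ov -eq_expg_mod_order eq_mulVg1 v1.
have w1: w ^+ l * w ^- k = 1 by rewrite -eqvw1.
apply: (mulIg (w ^- k)); rewrite mulgV -w1; congr (_ * _).
by apply/eqP; rewrite eq_expg_mod_order ow eq_lm.
Qed.

Theorem theorem1p9 (p q : nat) (gT : finGroupType) (P : {group gT})
    (alpha : {perm gT}) :
  prime p -> prime q -> maximal_pair p q P alpha -> 2 < q -> nil_class P <= 2.
Proof.
move=> pr_p pr_q [d [pP [AutPa [oa _]] [mP mS] [powa nta] _]] q_gt2.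
have nPhiP := subsetP (normal_norm (Phi_normal P)).
have abV : p.-abelem (P / 'Phi(P)) := Phi_quotient_abelem pP.
have aP : alpha @: P = P by rewrite -[RHS](im_autm AutPa) morphimEdom.
have actE x : x \in P ->
    Frattini_aut P alpha (coset 'Phi(P) x) = coset 'Phi(P) (alpha x).
  exact: (Frattini_autE (subxx P) AutPa aP).
have [m am] := power_aut_abelem pr_p abV powa.
have alphaP x : x \in P -> alpha x \in P by apply: Aut_closed.
have iter_a k x : x \in P ->
    coset 'Phi(P) ((alpha ^+ k) x) = coset 'Phi(P) x ^+ (m ^ k).
  elim: k x => [|k IHk] x Px; first by rewrite perm1 expg1.
  rewrite expgS permM IHk ?alphaP // -actE // am ?mem_quotient //.
  by rewrite -expgM -expnS.
(* A moved element [u] has order p, so congruences modulo p can be tested on its powers. *)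
have [u Vu neu]: exists2 u, u \in P / 'Phi(P) & Frattini_aut P alpha u != u.
  apply/exists_inP; apply: contra_notT nta; rewrite negb_exists_in.
  move/forall_inP=> fixa; apply: (eq_Aut (proj1 powa) (group1 _)) => x Vx.
  by rewrite perm1; apply/eqP/negPn/fixa.
have ou: #[u] = p.
  apply: nt_prime_order => //; first by case/(abelemP pr_p): abV => _ ->.
  by apply: contraNneq neu => u1; rewrite am // u1 expg1n.
have m1 : m != 1 %[mod p].
  by apply: contra neu; rewrite am // -ou -eq_expg_mod_order expg1.
have mq : m ^ q = 1 %[mod p].
  apply/eqP; rewrite -ou -eq_expg_mod_order expg1.
  have /morphimP[x _ Px ->] := Vu.
  by rewrite -iter_a // -oa expg_order perm1.
have co_mp : coprime p m.
  rewrite prime_coprime //; apply/negP=> p_m.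
  have := mq; rewrite -modnXm (eqP p_m) exp0n ?prime_gt0 // mod0n.
  by rewrite modn_small ?prime_gt1.
have m2 : m ^ 2 != 1 %[mod p].
  (* As q is odd, m ^ q = m * (m ^ 2) ^ q./2; thus m ^ 2 = 1 would give m = 1. *)
  apply: contra m1 => /eqP m2; rewrite -mq -[q]odd_double_half.
  have -> : odd q by case: (even_prime pr_q) q_gt2 => [->|].
  rewrite -muln2 mulnC expnD expn1 expnM -modnMmr -modnXm m2.
  by rewrite modnXm exp1n modnMmr muln1.
apply/(lcn_nil_classP 2 (pgroup_nil pP)).
pose to := ([Aut P])%gact.
pose f := [morphism of sdpair1 to].
have injf : 'injm f := injm_sdpair1 to.
have Lf : 'L_3(f @* P) = 1.
  apply: (@scalar_aut_lcn3_eq1 _ p m _ (sdpair2 to alpha)); rewrite ?morphim_pgroup //.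
  - apply: (subsetP (im_sdpair_norm to)).
    by rewrite mem_morphim.
  - move=> _ /morphimP[x _ Px ->].
    have <- : f (alpha x) = f x ^ sdpair2 to alpha by apply: sdpair_act.
    rewrite -injm_Phi // -morphX // -morphV ?groupX // -morphM ?groupV ?groupX ?alphaP //.
    have nx := nPhiP x Px; have nax := nPhiP _ (alphaP x Px).
    apply: mem_morphim; first by rewrite groupM ?groupV ?groupX ?alphaP.
    apply: coset_idr; first by rewrite groupM ?groupV ?groupX.
    rewrite morphM ?groupV ?groupX // morphV ?groupX // morphX //.
    by rewrite /= -actE // am ?mem_quotient // mulVg.
  move=> H sHP; rewrite -injm_Phi // index_injm //.
  have sKP : f @*^-1 H \subset P := subsetIl _ _.
  have <- : f @* (f @*^-1 H) = H := morphpreK sHP.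
  apply: leq_trans (morphim_grank f sKP) _.
  by apply: leq_trans (mS _ sKP) _; rewrite -mP grank_leq_logn_Phi.
have := Lf; rewrite -morphim_lcn // => /eqP; rewrite morphim_injm_eq1 ?lcn_sub //.
by move/eqP.
Qed.
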